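(* Let $I \subset R = K[\mathcal{A}]$ be a square-free monomial ideal and suppose that its labeled hypergraph $\mathcal{H}(I) = (V, X, E, \mathcal{E})$ has only isolated open vertices. Then \[\mathrm{reg}(R/I) \le |X| - |V|.\]
   Context: $K$ is a field, $\mathcal{A}$ is a finite set of symbols regarded as variables, and $R = K[\mathcal{A}]$ is the polynomial ring with the standard grading (every variable has degree one). For a finitely generated graded $R$-module $M$ with graded Betti numbers $\beta_{ij}(M)$ (so that the $i$th module of the minimal graded free resolution is $\bigoplus_j R(-j)^{\beta_{ij}(M)}$), $\mathrm{reg}(M) = \max\{j-i : \beta_{ij}(M)\neq 0 \text{ for some } i\}$. Labeled hypergraph of an ideal: let $I\subset R$ be a square-free monomial ideal with minimal monomial generating set $\{f_1,\ldots,f_\mu\}$. Its labeled hypergraph is $\mathcal{H}(I) = (V,X,E,\mathcal{E})$ where $V = \{1,\ldots,\mu\}$; $E$ is the function from $\mathcal{A}$ to the power set of $V$ given by $E_a = E(a) = \{j : a \text{ divides } f_j\}$; $X = \{a\in\mathcal{A} : E_a\neq\emptyset\}$ (so $|X|$ is the number of variables appearing in the minimal generators); and $\mathcal{E} = \mathrm{Im}(E)$ is the set of edges. A vertex $v\in V$ is closed if $\{v\}\in\mathcal{E}$, and open otherwise. The set of neighbors of $v$ is $N_{\mathcal{H}}(v) = \{w\in V : w\neq v \text{ and there is } F\in\mathcal{E} \text{ with } v,w\in F\}$. The hypergraph has (only) isolated open vertices if for every open vertex $v$ and every $w\in N_{\mathcal{H}}(v)$, $w$ is closed. *)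

(* Defs.v *)
From HB Require Import structures.
(* mpoly must be imported before the analysis libraries: their notations
   clash in the other order. *)
From mathcomp Require Import all_boot all_order all_algebra generic_quotient.
From mathcomp Require Import ring_quotient mpoly.
From mathcomp Require Import boolp constructive_ereal.
From mathcomp Require classical_sets.

Set Implicit Arguments.
Unset Strict Implicit.
Unset Printing Implicit Defensive.

Import GRing.Theory.

Local Open Scope ring_scope.
Local Open Scope quotient_scope.

(** * Labeled hypergraphs *)

(* A labeled hypergraph on the vertex set V with label set A is given by its
   incidence function E; an edge may carry several labels. *)
Section Hypergraph.
Variables (A V : finType) (E : A -> {set V}).

Definition hg_labels : {set A} := [set a | E a != set0].

Definition hg_edges : {set {set V}} := [set E a | a : A].

Definition hg_closed (v : V) : bool := [set v] \in hg_edges.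

Definition hg_open (v : V) : bool := ~~ hg_closed v.

Definition hg_neighbors (v : V) : {set V} :=
  [set w | (w != v) && [exists F in hg_edges, (v \in F) && (w \in F)]].

Definition isolated_open_vertices : Prop :=
  forall v w : V, hg_open v -> w \in hg_neighbors v -> hg_closed w.

End Hypergraph.

(** * Monomial ideals *)

(* An ideal of the commutative ring R is a submodule of R^o, that is, of R
   seen as a module over itself. *)
Notation ideal R := (submodClosed R^o).

Section MonomialIdeals.
Variables (K : fieldType) (n : nat).
Local Notation R := {mpoly K[n]}.

Definition monomials_generate (S : 'X_{1..n} -> Prop) (I : ideal R) : Prop :=
  forall p : R, p \in I <->
    exists s : seq (R * 'X_{1..n}),
      (forall x, x \in s -> S x.2) /\ p = \sum_(x <- s) x.1 * 'X_[x.2].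

Definition squarefree (m : 'X_{1..n}) : Prop := forall a : 'I_n, (m a <= 1)%N.

Definition squarefree_monomial_ideal (I : ideal R) : Prop :=
  exists S, (forall m, S m -> squarefree m) /\ monomials_generate S I.

(* f enumerates without repetition a set of monomials that generates I and
   no proper subset of which generates I. *)
Definition minimal_monomial_generators (mu : nat) (f : 'I_mu -> 'X_{1..n})
    (I : ideal R) : Prop :=
  [/\ injective f,
      monomials_generate (fun m => exists j, f j = m) I
    & forall J : {set 'I_mu},
        monomials_generate (fun m => exists2 j, j \in J & f j = m) I ->
        J = [set: 'I_mu]].

(* The incidence function of the labeled hypergraph of the ideal minimally
   generated by the monomials f j. *)
Definition hypergraph_of (mu : nat) (f : 'I_mu -> 'X_{1..n}) (a : 'I_n) :
  {set 'I_mu} := [set j | (U_(a) <= f j)%MM].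

End MonomialIdeals.

(** * Quotient modules *)

Section QuotientModule.
Variables (R : comNzRingType) (V : lmodType R) (N : submodClosed V).

Definition submod_pred : {pred V} := N.

Fact submod_pred_zmod_closed : zmod_closed submod_pred.
Proof.
split=> [|x y xN yN]; first exact: rpred0 N.
by rewrite /submod_pred -scaleN1r; apply: (rpredD xN); apply: rpredZ.
Qed.

HB.instance Definition _ :=
  GRing.isZmodClosed.Build V submod_pred submod_pred_zmod_closed.

Definition quotmod : Type := Quotient.quot submod_pred.

HB.instance Definition _ := GRing.Zmodule.on quotmod.

Definition quotmod_proj (x : V) : quotmod := \pi_(Quotient.quot submod_pred) x.

Definition quotmod_scale (c : R) (x : quotmod) : quotmod :=
  quotmod_proj (c *: repr (x : Quotient.quot submod_pred)).

Lemma quotmod_projP x y : (quotmod_proj x = quotmod_proj y) <-> x - y \in N.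
Proof.
have e := Quotient.idealrBE submod_pred x y.
by split=> [h|h]; [change (x - y \in submod_pred); rewrite e; apply/eqP
  | apply/eqP; rewrite -e].
Qed.

Lemma quotmod_reprK (x : quotmod) :
  quotmod_proj (repr (x : Quotient.quot submod_pred)) = x.
Proof. exact: reprK. Qed.

Lemma quotmod_projB : {morph quotmod_proj : x y / x - y >-> x - y}.
Proof. exact: raddfB. Qed.

Lemma quotmod_projD : {morph quotmod_proj : x y / x + y >-> x + y}.
Proof. exact: raddfD. Qed.

Lemma quotmod_projZ c x :
  quotmod_proj (c *: x) = quotmod_scale c (quotmod_proj x).
Proof.
apply/quotmod_projP; rewrite -scalerBr; apply: rpredZ.
by apply/quotmod_projP; rewrite quotmod_reprK.
Qed.

Lemma quotmod_ind (P : quotmod -> Prop) :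
  (forall x, P (quotmod_proj x)) -> forall x, P x.
Proof. by move=> h x; rewrite -(quotmod_reprK x). Qed.

Fact quotmod_scaleA a b v :
  quotmod_scale a (quotmod_scale b v) = quotmod_scale (a * b) v.
Proof.
by elim/quotmod_ind: v => v; rewrite -!quotmod_projZ scalerA.
Qed.

Fact quotmod_scale1 : left_id 1 quotmod_scale.
Proof. by elim/quotmod_ind => v; rewrite -quotmod_projZ scale1r. Qed.

Fact quotmod_scaleDr : right_distributive quotmod_scale +%R.
Proof.
move=> a; elim/quotmod_ind => u; elim/quotmod_ind => v.
by rewrite -quotmod_projD -!quotmod_projZ scalerDr quotmod_projD.
Qed.

Fact quotmod_scaleDl v : {morph quotmod_scale^~ v : a b / a + b}.
Proof.
move=> a b; elim/quotmod_ind: v => v.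
by rewrite -!quotmod_projZ scalerDl quotmod_projD.
Qed.

HB.instance Definition _ := GRing.Zmodule_isLmodule.Build R quotmod
  quotmod_scaleA quotmod_scale1 quotmod_scaleDr quotmod_scaleDl.

End QuotientModule.

(** * Graded modules and Castelnuovo-Mumford regularity *)

Section Regularity.
Variables (K : fieldType) (n : nat).
Local Notation R := {mpoly K[n]}.

(* The degree d component of R for the standard grading, with d an integer. *)
Definition mpoly_degree (d : int) (p : R) : Prop :=
  if d is Posz k then p \is k.-homog else p = 0.

(* A graded module is given by a module M and its homogeneous components,
   the degree d component being the set of x such that gr d x. *)
Section Resolution.
Variables (M : lmodType R) (gr : int -> M -> Prop).

(* The i-th module of the resolution is the free module of rows of length
   mres_rank i, whose k-th basis vector sits in degree mres_shift i k, i.e. the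
   direct sum over k of the R(- mres_shift i k); the differentials act on rows
   by multiplication on the right. *)
Record minimal_graded_free_resolution := MinimalGradedFreeResolution {
  mres_rank : nat -> nat;
  mres_shift : forall i, 'I_(mres_rank i) -> int;
  mres_diff : forall i, 'M[R]_(mres_rank i.+1, mres_rank i);
  mres_aug : {linear 'rV[R]_(mres_rank 0) -> M};
  mres_diff_graded : forall i k l,
    mpoly_degree (mres_shift k - mres_shift l) (mres_diff i k l);
  mres_aug_graded : forall k : 'I_(mres_rank 0),
    gr (mres_shift k) (mres_aug (delta_mx 0 k));
  mres_aug_surj : forall x : M, exists u, mres_aug u = x;
  mres_exact0 : forall u : 'rV[R]_(mres_rank 0),
    mres_aug u = 0 <-> exists w, u = w *m mres_diff 0;
  mres_exactS : forall i (u : 'rV[R]_(mres_rank i.+1)),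
    u *m mres_diff i = 0 <-> exists w, u = w *m mres_diff i.+1;
  (* the image of each differential lies in the irrelevant ideal times its
     target *)
  mres_minimal : forall i k l, (mres_diff i k l)@_0%MM = 0
}.

(* beta_ij: the number of summands R(-j) in the i-th module of the minimal
   graded free resolution, which is unique up to isomorphism. *)
Definition graded_betti (i : nat) (j : int) : nat :=
  classical_sets.xget 0%N (fun b => exists F : minimal_graded_free_resolution,
    #|[set k : 'I_(mres_rank F i) | mres_shift k == j]| = b).

(* r is the least upper bound of the j - i such that beta_ij is nonzero. It is
   their maximum if M is a nonzero finitely generated graded module, and -oo
   if M = 0. *)
Definition is_regularity (r : \bar int) : Prop :=
  (forall i j, graded_betti i j <> 0%N -> ((j - i%:Z)%:E <= r)%O) /\
  (forall s : \bar int,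
    (forall i j, graded_betti i j <> 0%N -> ((j - i%:Z)%:E <= s)%O) ->
    (r <= s)%O).

Definition regularity : \bar int := classical_sets.xget +oo%E is_regularity.

End Resolution.

(* R/I with the grading induced by the standard grading of R. *)
Definition quot_grading (I : ideal R) (d : int) (x : quotmod I) : Prop :=
  exists2 p : R, mpoly_degree d p & x = quotmod_proj I p.

Definition reg_quot (I : ideal R) : \bar int := regularity (@quot_grading I).

End Regularity.

(* Main.v *)
Require Import Defs.
From mathcomp Require Import all_boot all_order all_algebra mpoly.
From mathcomp Require Import constructive_ereal.
From HB Require Import structures.
From mathcomp Require Import ring zify.
From mathcomp Require Import boolp.
From mathcomp Require classical_sets.

(** Regularity can be read off the Koszul homology H_i(x; R/I), which in
internal degree j has dimension beta_ij: the claim is that it vanishes as soon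
as j - i > |X| - |V|.  The homology is handled through chains z indexed by
sets of variables, all homological degrees i = #|S| at once; then j - i is just
the common degree of the values of z, and Koszul regularity at r means that
every cycle with values in one degree e > r is a boundary.

On the algebraic side this property has two virtues.  For a short exact
sequence it passes from the outer modules to the middle one by a chase, so the
sequence 0 -> R/(I : a)(-1) -> R/I -> R/(I + a) -> 0 bounds R/I by r once the
outer ideals are bounded by r - 1 and r ([koszul_vanishing_split]).  And it
passes from a module to its first syzygies with r replaced by r + 1
([syzygy_regularS]), because the Koszul complex of a free module is acyclic
([koszul_acyclic]) and minimality removes the constant terms that carry its
H_0.  A basis vector of degree > r + t in step t of any minimal resolution
would then have to lie in the irrelevant ideal times the free module plus the
syzygies, which minimality forbids ([resolution_shift_le]).  The bound thus
holds for every minimal resolution, hence for the Betti numbers.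

On the combinatorial side, square-free monomials are replaced by their supports:
the generators form an antichain H of sets of variables, a closed vertex is a
member that owns a variable, and |X| - |V| is #|cover H| - #|H|.  Adding a
variable a to I deletes the members through a; taking the colon by a
erases a and discards the members that become redundant.  Isolated open
vertices make both operations harmless: when a lies in two members, the members
through a are closed except at most one, so with them one loses
at least as many variables, namely a and the variables owned by the closed
ones ([cover_deletion]); and a redundant member is always closed, so each one
discarded takes away a variable of its own, on top of a
([cover_contraction]).  Both operations preserve the hypotheses, and induction
on the number of variables concludes ([koszul_vanishing_antichain]); if no
variable lies in two members, the members are disjoint and any variable does. *)

Set Implicit Arguments.
Unset Strict Implicit.
Unset Printing Implicit Defensive.

Import Order.TTheory GRing.Theory Num.Theory.

Local Open Scope ring_scope.

(** * Polynomials through their monomials *)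

Section MonomialSupport.
Variables (K : fieldType) (n : nat).
Local Notation R := {mpoly K[n]}.
Implicit Types (p q : R) (a b : 'I_n) (m : 'X_{1..n}) (T U : 'X_{1..n} -> Prop).

Lemma mcoeffXM a p m :
  ('X_a * p)@_m = if (0 < m a)%N then p@_(m - U_(a)) else 0.
Proof.
rewrite mulrC; case: ifP => [ma|/negbT ma].
  rewrite -{1}(@submK _ U_(a)%MM m); first by rewrite addmC mcoeffMX.
  by rewrite lep1mP -lt0n.
apply: memN_msupp_eq0; apply/negP; rewrite (perm_mem (msuppMX p U_(a))).
case/mapP => k _ mE; move: ma; rewrite mE mnmDE mnm1E eqxx.
by [].
Qed.

Lemma big_msupp_pick p m (F : 'X_{1..n} -> K) : (p@_m = 0 -> F m = 0) ->
  \sum_(k <- msupp p) (if k == m then F k else 0) = F m.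
Proof.
move=> F0; have [mp|mp] := boolP (m \in msupp p); last first.
  rewrite F0 ?memN_msupp_eq0 // big_seq big1 // => k kp.
  by case: eqP => // km; rewrite -km kp in mp.
rewrite (bigD1_seq m) ?msupp_uniq //= eqxx big1 ?addr0 // => k.
by move/negbTE ->.
Qed.

Definition mfilter (P : pred 'X_{1..n}) p : R :=
  \sum_(m <- msupp p) (if P m then p@_m else 0) *: 'X_[m].

Lemma mcoeff_mfilter P p m : (mfilter P p)@_m = if P m then p@_m else 0.
Proof.
rewrite -[RHS](big_msupp_pick (p := p) (F := fun k => if P k then p@_k else 0)).
  rewrite raddf_sum; apply: eq_bigr => k _ /=.
  by rewrite mcoeffZ mcoeffX; case: eqP; rewrite ?mulr1 ?mulr0.
by move=> ->; case: ifP.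
Qed.

(** The difference quotient in the variable 'X_a: the part of p divisible by
'X_a, divided by 'X_a. *)
Definition mdivX a p : R :=
  \sum_(m <- msupp p) (if (0 < m a)%N then p@_m else 0) *: 'X_[m - U_(a)].

Lemma mcoeff_mdivX a p m : (mdivX a p)@_m = p@_(m + U_(a)).
Proof.
rewrite -[RHS](@big_msupp_pick p _ (fun k => p@_k)) // raddf_sum.
apply: eq_bigr => k _ /=; rewrite mcoeffZ mcoeffX.
case: ifP => [ka|/negbT ka]; last first.
  rewrite mul0r; case: eqP => // kE.
  by move: ka; rewrite kE mnmDE mnm1E eqxx addn1.
have kE : ((k - U_(a)) + U_(a) = k)%MM by rewrite submK // lep1mP -lt0n.
have -> : ((k - U_(a))%MM == m) = (k == (m + U_(a))%MM).
  by rewrite -{2}kE eqm_add2r.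
by case: eqP => _; rewrite ?mulr1 ?mulr0.
Qed.

Fact mdivX_is_zmod_morphism a : zmod_morphism (mdivX a).
Proof.
by move=> p q; apply/mpolyP => m; rewrite !(mcoeffB, mcoeff_mdivX).
Qed.

HB.instance Definition _ a :=
  GRing.isZmodMorphism.Build R R (mdivX a) (mdivX_is_zmod_morphism a).

Lemma mdivX_sign a k p : mdivX a ((-1) ^+ k * p) = (-1) ^+ k * mdivX a p.
Proof. by rewrite -signr_odd; case: odd; rewrite ?mulN1r ?mul1r ?raddfN. Qed.

Lemma mdivXK a p : mdivX a ('X_a * p) = p.
Proof.
by apply/mpolyP => m; rewrite mcoeff_mdivX mcoeffXM mnmDE mnm1E eqxx addn1 /= addmK.
Qed.

Lemma mdivX_mulC a b p : a != b -> mdivX a ('X_b * p) = 'X_b * mdivX a p.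
Proof.
move=> ab; apply/mpolyP => m.
rewrite mcoeff_mdivX !mcoeffXM mnmDE mnm1E (negbTE ab) addn0.
case: ifP => // mb; rewrite mcoeff_mdivX; congr (_@__).
by rewrite [RHS]addmC addmBA ?lep1mP -?lt0n // [in RHS]addmC.
Qed.

(** Monomial ideals and homogeneous components are both sets of this form; for
T closed under multiplication by variables it is the monomial ideal spanned by
the monomials in T. *)
Definition mspan T p : Prop := forall m, p@_m != 0 -> T m.

Lemma mspan0 T : mspan T 0.
Proof. by move=> m; rewrite mcoeff0 eqxx. Qed.

Lemma mspanD T p q : mspan T p -> mspan T q -> mspan T (p + q).
Proof.
move=> pT qT m; rewrite mcoeffD => nz.
have [p0|p0] := eqVneq p@_m 0; last exact: pT.
by apply: qT; apply: contraNneq nz => ->; rewrite p0 addr0.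
Qed.

Lemma mspanN T p : mspan T p -> mspan T (- p).
Proof. by move=> pT m; rewrite mcoeffN oppr_eq0; apply: pT. Qed.

Lemma mspanB T p q : mspan T p -> mspan T q -> mspan T (p - q).
Proof. by move=> pT qT; apply: mspanD => //; apply: mspanN. Qed.

Lemma mspan_sum T (J : Type) (s : seq J) (P : pred J) (F : J -> R) :
  (forall i, P i -> mspan T (F i)) -> mspan T (\sum_(i <- s | P i) F i).
Proof.
by move=> FT; elim/big_ind: _ => //; [apply: mspan0 | move=> p q; apply: mspanD].
Qed.

Lemma mspan_sign T k p : mspan T p -> mspan T ((-1) ^+ k * p).
Proof.
by move=> pT; rewrite -signr_odd; case: odd; rewrite ?mulN1r ?mul1r //; apply: mspanN.
Qed.

Lemma mspanXM T U a p : (forall m, T m -> U (m + U_(a))%MM) -> mspan T p ->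
  mspan U ('X_a * p).
Proof.
move=> TU pT m; rewrite mcoeffXM; case: ifP => [ma|]; last by rewrite eqxx.
by move=> /pT/TU; rewrite submK // lep1mP -lt0n.
Qed.

Lemma mspan_mdivX T a p : mspan T p -> mspan (fun m => T (m + U_(a))%MM) (mdivX a p).
Proof. by move=> pT m; rewrite mcoeff_mdivX; apply: pT. Qed.

Lemma mspanM (T U W : 'X_{1..n} -> Prop) p q :
  (forall m k, T m -> U k -> W (m + k)%MM) -> mspan T p -> mspan U q -> mspan W (p * q).
Proof.
move=> TUW pT qU m nz.
have : m \in msupp (p * q) by rewrite mcoeff_msupp.
move=> /msuppM_le /allpairsP[[k l] /= [kp lq ->]].
by apply: TUW; [apply: pT | apply: qU]; rewrite -mcoeff_msupp.
Qed.

(** Degrees range over int, so that the component of degree -1 makes sense and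
is zero. *)
Definition mpoly_component (d : int) p : R := mfilter (fun m => (mdeg m)%:Z == d) p.

Lemma mpoly_degreeP d p : mpoly_degree d p <-> mspan (fun m => (mdeg m)%:Z = d) p.
Proof.
case: d => d /=; last first.
  by split=> [-> //|h]; [apply: mspan0|apply/mpolyP => m; rewrite mcoeff0; apply/eqP;
    apply/negPn/negP => /h].
split=> [/dhomogP h m|h].
  by rewrite -mcoeff_msupp => /h ->.
by apply/dhomogP => m; rewrite mcoeff_msupp => /h [].
Qed.

End MonomialSupport.

(** * The Koszul complex *)

Section Koszul.
Variables (K : fieldType) (n : nat).
Local Notation R := {mpoly K[n]}.
Implicit Types (a b : 'I_n) (S : {set 'I_n}).

Definition koszul_sign a S : R := (-1) ^+ #|[set b in S | (b < a)%N]|.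

(** The Koszul differential on chains z = sum_S z(S) e_S with coefficients
in M, in all homological degrees #|S| at once. *)
Definition koszul (M : lmodType R) (z : {set 'I_n} -> M) S : M :=
  \sum_(a | a \notin S) (koszul_sign a S * 'X_a) *: z (a |: S).

Lemma koszul_signU1 a b S : b \notin S ->
  koszul_sign a (b |: S) = (-1) ^+ (b < a)%N * koszul_sign a S.
Proof.
move=> bS; rewrite /koszul_sign -exprD; congr (_ ^+ _).
have [ba|ba] := boolP (b < a)%N.
  have -> : [set c in b |: S | (c < a)%N] = b |: [set c in S | (c < a)%N].
    by apply/setP => c; rewrite !inE; case: eqP => // ->; rewrite ba.
  by rewrite cardsU1 inE (negbTE bS).
apply: eq_card => c; rewrite !inE; case: eqP => // ->.
by rewrite (negbTE ba) (negbTE bS).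
Qed.

Lemma koszul_signK a S : koszul_sign a S * koszul_sign a S = 1.
Proof. by rewrite -expr2 sqrr_sign. Qed.

Lemma sign_ltn_neq a b : a != b ->
  (-1) ^+ (b < a)%N = - (-1) ^+ (a < b)%N :> R.
Proof.
rewrite -val_eqE /=; case: ltngtP => // _ _; first by rewrite expr0 expr1 opprK.
Qed.

Lemma koszul_sign_swap a b S : a != b -> a \notin S -> b \notin S ->
  koszul_sign a S * koszul_sign b (a |: S) =
  - (koszul_sign b S * koszul_sign a (b |: S)).
Proof.
move=> ab aS bS; rewrite !koszul_signU1 // (sign_ltn_neq ab).
by move: (koszul_sign a S) (koszul_sign b S) (_ ^+ _) => s t u; ring.
Qed.

Lemma koszul_signU_swap a b S : a != b -> a \notin S -> b \notin S ->
  koszul_sign b (a |: S) * koszul_sign a (b |: S) =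
  - (koszul_sign a S * koszul_sign b S).
Proof.
move=> ab aS bS; rewrite !koszul_signU1 // (sign_ltn_neq ab).
have := sqrr_sign R (a < b)%N.
move: (koszul_sign a S) (koszul_sign b S) ((-1) ^+ _) => s t u u2.
by transitivity (- (u ^+ 2 * (s * t))); [ring | rewrite u2 mul1r].
Qed.

Section Linear.
Variable M : lmodType R.
Implicit Types z w : {set 'I_n} -> M.

Lemma eq_koszul z w : z =1 w -> koszul z =1 koszul w.
Proof. by move=> zw S; apply: eq_bigr => a _; rewrite zw. Qed.

Lemma koszulD z w S : koszul (fun S => z S + w S) S = koszul z S + koszul w S.
Proof. by rewrite -big_split; apply: eq_bigr => a _ /=; rewrite scalerDr. Qed.

Lemma koszulB z w S : koszul (fun S => z S - w S) S = koszul z S - koszul w S.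
Proof. by rewrite -sumrB; apply: eq_bigr => a _ /=; rewrite scalerBr. Qed.

Lemma koszulZ c z S : koszul (fun S => c *: z S) S = c *: koszul z S.
Proof.
by rewrite /koszul scaler_sumr; apply: eq_bigr => a _; rewrite !scalerA mulrC.
Qed.

Lemma koszul_linear (N : lmodType R) (f : {linear M -> N}) z S :
  f (koszul z S) = koszul (fun S => f (z S)) S.
Proof. by rewrite raddf_sum; apply: eq_bigr => a _ /=; rewrite linearZ. Qed.

(** The terms of the double sum at (a, b) and (b, a) are opposite; the pairs
with a < b are matched with those with b < a so that no division by 2 is
needed. *)
Lemma koszul_koszul z S : koszul (koszul z) S = 0.
Proof.
pose F a b : M :=
  (koszul_sign a S * 'X_a * (koszul_sign b (a |: S) * 'X_b)) *: z (b |: (a |: S)).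
pose P a b := [&& a \notin S, b \notin S & a != b].
have FN a b : P a b -> F a b = - F b a.
  case/and3P => aS bS ab; rewrite /F (setUCA [set b]) -scaleNr; congr (_ *: _).
  have := koszul_sign_swap ab aS bS; set s := koszul_sign a S => E.
  transitivity ((s * koszul_sign b (a |: S)) * ('X_a * 'X_b)); first by ring.
  by rewrite E; ring.
have -> : koszul (koszul z) S = \sum_a \sum_(b | P a b) F a b.
  rewrite /koszul [LHS]big_mkcond; apply: eq_bigr => a _.
  rewrite /P; case: (boolP (a \in S)) => aS /=; first by rewrite big_pred0.
  rewrite scaler_sumr; apply: eq_big => [b|b _]; last by rewrite scalerA.
  by rewrite !inE negb_or andbC eq_sym.
pose L := \sum_a \sum_(b | P a b && (a < b)%N) F a b.
pose G := \sum_a \sum_(b | P a b && ~~ (a < b)%N) F a b.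
have -> : \sum_a \sum_(b | P a b) F a b = L + G.
  rewrite -big_split; apply: eq_bigr => a _ /=.
  by rewrite (bigID (fun b : 'I_n => (a < b)%N)).
suff -> : L = - G by rewrite addNr.
rewrite /L (exchange_big_dep predT) //= -sumrN; apply: eq_bigr => a _.
rewrite -sumrN; apply: eq_big => [b|b /andP[/FN]//].
rewrite /P (eq_sym b); case: (boolP (a == b)) => [_|]; first by rewrite !andbF.
rewrite -val_eqE /= -leqNgt => ab.
by rewrite andbCA [in RHS]leq_eqVlt eq_sym (negbTE ab).
Qed.

End Linear.

Lemma koszulE (z : {set 'I_n} -> R^o) S :
  koszul z S = \sum_(a | a \notin S) koszul_sign a S * ('X_a * z (a |: S)) :> R.
Proof. by apply: eq_bigr => a _; rewrite mulrA. Qed.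

Lemma mspan_koszul (T U : 'X_{1..n} -> Prop) (z : {set 'I_n} -> R^o) S :
  (forall a m, T m -> U (m + U_(a))%MM) -> (forall S, mspan T (z S)) ->
  mspan U (koszul z S).
Proof.
move=> TU zT; rewrite koszulE; apply: mspan_sum => a _.
by apply: mspan_sign; apply: mspanXM (zT _); apply: TU.
Qed.

Lemma mdivX_koszul_sign a b S (p : R) :
  mdivX a (koszul_sign b S * p) = koszul_sign b S * mdivX a p.
Proof. exact: mdivX_sign. Qed.

(** The homotopy e_a /\ (difference quotient in 'X_a); it contracts the Koszul
complex of R onto the chains free of both 'X_a and e_a. *)
Definition koszul_homotopy a (z : {set 'I_n} -> R^o) S : R^o :=
  if a \in S then koszul_sign a (S :\ a) * mdivX a (z (S :\ a)) else 0.

Definition koszul_eval a (z : {set 'I_n} -> R^o) S : R^o :=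
  if a \in S then 0 else z S - 'X_a * mdivX a (z S).

(** The homotopy identity d h + h d = 1 - eval.  Off a, only the index a
contributes to d h, giving the part of z(S) divisible by 'X_a; on a, the terms
of d h and h d of index b != a cancel by the sign rule. *)
Lemma koszul_homotopyP a (z : {set 'I_n} -> R^o) S :
  z S = koszul_eval a z S + koszul (koszul_homotopy a z) S +
        koszul_homotopy a (koszul z) S :> R.
Proof.
rewrite koszulE /koszul_homotopy /koszul_eval.
have [aS|aS] := boolP (a \in S); last first.
  rewrite addr0 (bigD1 a) //= setU11 setU1K // big1 => [|b /andP[bS ba]].
    by rewrite addr0 mulrCA [X in _ + _ * X]mulrA koszul_signK mul1r subrK.
  by rewrite !inE eq_sym (negbTE ba) (negbTE aS) /= !mulr0.
rewrite add0r koszulE raddf_sum [\sum_(i | i \notin S :\ a) _](bigD1 a) ?setD11 //=.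
rewrite mdivX_koszul_sign mdivXK setD1K //.
rewrite mulrDr mulrA koszul_signK mul1r addrCA -[LHS]addr0; congr (_ + _).
apply/esym/eqP; rewrite addr_eq0 mulr_sumr -sumrN; apply/eqP.
apply: eq_big => [b|b bS].
  by rewrite !inE negb_and negbK; case: eqP => [->|_]; rewrite ?aS ?andbT.
have ba : b != a by apply: contraNneq bS => ->.
have -> : (b |: S) :\ a = b |: S :\ a.
  by apply/setP => c; rewrite !inE; case: (c =P b) => [->|]; rewrite ?ba.
have aD : a \notin S :\ a by rewrite setD11.
have bD : b \notin S :\ a by rewrite !inE negb_and bS orbT.
rewrite !inE aS orbT mdivX_koszul_sign mdivX_mulC 1?eq_sym //.
have := koszul_signU_swap _ aD bD; rewrite eq_sym setD1K // => /(_ ba).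
move=> stuv; rewrite [X in _ * X]mulrCA [LHS]mulrA stuv.
by rewrite mulNr -mulrA.
Qed.

Lemma mcoeff_koszul_eval a (z : {set 'I_n} -> R^o) S (m : 'X_{1..n}) :
  (koszul_eval a z S : R)@_m != 0 -> m a = 0%N /\ (z S : R)@_m != 0.
Proof.
rewrite /koszul_eval; case: ifP => _; first by rewrite mcoeff0 eqxx.
rewrite mcoeffB mcoeffXM; case: (posnP (m a)) => ma; first by rewrite subr0.
by rewrite mcoeff_mdivX submK ?lep1mP -?lt0n // subrr eqxx.
Qed.

Definition hits (Y : {set 'I_n}) (m : 'X_{1..n}) : bool := [exists a in Y, 0 < m a]%N.

(** Contracting the variables of l one after the other.  A variable of Y needs
no contraction since its multiples are already zero modulo Y; for the others,
the homotopy preserves the ideal generated by Y. *)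
Lemma koszul_acyclic_seq (Y : {set 'I_n}) (l : seq 'I_n) (z : {set 'I_n} -> R^o) :
  (forall S, mspan (hits Y) (koszul z S)) ->
  (forall S, mspan (fun m => hits Y m \/ has (fun a => 0 < m a)%N l) (z S)) ->
  exists w : {set 'I_n} -> R^o, forall S, mspan (hits Y) (z S - koszul w S : R).
Proof.
elim: l z => [|a l IH] z dz zl.
  exists (fun=> 0) => S; rewrite [koszul _ _]big1 => [|a _]; last by rewrite scaler0.
  by rewrite subr0 => m /zl[].
have [aY|aY] := boolP (a \in Y).
  apply: IH => // S m /zl /= [|/orP[ma|]]; [by left | left | by right].
  by apply/existsP; exists a; rewrite aY.
have hdz S : mspan (hits Y) (koszul_homotopy a (koszul z) S).
  rewrite /koszul_homotopy; case: ifP => _; last exact: mspan0.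
  apply: mspan_sign => m; rewrite mcoeff_mdivX => /dz/existsP[b /andP[bY]].
  rewrite mnmDE mnm1E; case: eqP => [ab|_]; first by rewrite ab bY in aY.
  by rewrite addn0 => mb; apply/existsP; exists b; rewrite bY.
have zE S : koszul_eval a z S =
    z S - koszul (koszul_homotopy a z) S - koszul_homotopy a (koszul z) S.
  apply/esym/eqP; rewrite !subr_eq addrAC; apply/eqP; exact: koszul_homotopyP.
have [|S m|w wP] := IH (koszul_eval a z).
- move=> S; rewrite (eq_koszul zE) !koszulB koszul_koszul subr0; apply: mspanB => //.
  apply: mspan_koszul hdz => b m /existsP[c /andP[cY mc]].
  by apply/existsP; exists c; rewrite cY mnmDE ltn_addr.
- move=> /mcoeff_koszul_eval[ma /zl /=]; rewrite ma /=; by [].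
exists (fun S => w S + koszul_homotopy a z S) => S.
have -> : z S - koszul (fun S => w S + koszul_homotopy a z S) S =
    (koszul_eval a z S - koszul w S) + koszul_homotopy a (koszul z) S.
  by rewrite koszulD zE [RHS]addrAC subrK opprD addrA addrAC.
exact: mspanD.
Qed.

(** The Koszul homology of R/(Y), with Y a set of variables, is represented by
constant chains, so a cycle without constant terms is a boundary.  The case of
empty Y is the acyclicity of the Koszul complex of R. *)
Lemma koszul_acyclic (Y : {set 'I_n}) (z : {set 'I_n} -> R^o) :
  (forall S, mspan (hits Y) (koszul z S)) ->
  (forall S, (z S : R)@_0%MM = 0) ->
  exists w : {set 'I_n} -> R^o, forall S, mspan (hits Y) (z S - koszul w S : R).
Proof.
move=> dz z0; apply: (koszul_acyclic_seq (l := enum 'I_n) dz) => S m zm; right.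
apply/hasP; have [m0|] := eqVneq m 0%MM; first by rewrite m0 z0 eqxx in zm.
rewrite -mdeg_eq0 mdegE sum_nat_eq0 negb_forall => /existsP[a].
by rewrite implyTb -lt0n => ma; exists a; rewrite ?mem_enum.
Qed.

End Koszul.

(** * Koszul homology of monomial ideals *)

Section Vanishing.
Variables (K : fieldType) (n : nat).
Local Notation R := {mpoly K[n]}.
Implicit Types (p q : R) (a b : 'I_n) (m : 'X_{1..n}) (T U : 'X_{1..n} -> Prop).

Local Notation of_degree e := (mspan (fun m => (mdeg m)%:Z = e)).

Fact mpoly_component_is_zmod_morphism d : zmod_morphism (@mpoly_component K n d).
Proof.
move=> p q; apply/mpolyP => m; rewrite mcoeffB !mcoeff_mfilter mcoeffB.
by case: ifP; rewrite ?subr0.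
Qed.

HB.instance Definition _ d :=
  GRing.isZmodMorphism.Build R R (@mpoly_component K n d)
    (mpoly_component_is_zmod_morphism d).

Lemma mpoly_componentXM d a p :
  mpoly_component d ('X_a * p) = 'X_a * mpoly_component (d - 1) p.
Proof.
apply/mpolyP => m; rewrite mcoeff_mfilter !mcoeffXM; case: (posnP (m a)) => ma.
  by rewrite if_same.
rewrite mcoeff_mfilter; have {1}-> : m = ((m - U_(a)) + U_(a))%MM.
  by rewrite submK // lep1mP -lt0n.
by rewrite mdegD mdeg1 PoszD eq_sym -subr_eq eq_sym.
Qed.

Lemma mpoly_component_koszul d (w : {set 'I_n} -> R^o) S :
  mpoly_component d (koszul w S) =
  koszul (fun S => mpoly_component (d - 1) (w S) : R^o) S.
Proof.
rewrite !koszulE raddf_sum; apply: eq_bigr => a _ /=; rewrite -mpoly_componentXM.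
rewrite /koszul_sign -signr_odd.
by case: odd; rewrite ?mulN1r ?mul1r ?raddfN.
Qed.

Lemma homog_component d p : of_degree d (mpoly_component d p).
Proof.
by move=> m; rewrite mcoeff_mfilter; case: (eqVneq _ d) => // _; rewrite eqxx.
Qed.

Lemma component_homog d p : of_degree d p -> mpoly_component d p = p.
Proof.
move=> h; apply/mpolyP => m; rewrite mcoeff_mfilter.
by case: eqP => // hm; apply/esym/eqP; apply: contra_notT hm => /h.
Qed.

Lemma mspan_component T d p : mspan T p -> mspan T (mpoly_component d p).
Proof.
by move=> h m; rewrite mcoeff_mfilter; case: ifP => _; [apply: h|rewrite eqxx].
Qed.

(** Vanishing of the Koszul homology H_i(x; R/I)_j for j - i > r, where I is the
span of T: a chain indexed by S with #|S| = i and of total degree j takes values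
in degree j - i.  Chains are written with representatives in R. *)
Definition koszul_vanishing T (r : int) : Prop :=
  forall (e : int) (z : {set 'I_n} -> R^o), r < e ->
  (forall S, of_degree e (z S)) -> (forall S, mspan T (koszul z S)) ->
  exists w : {set 'I_n} -> R^o, forall S, mspan T (z S - koszul w S).

Lemma koszul_vanishing_le T r s : r <= s -> koszul_vanishing T r -> koszul_vanishing T s.
Proof. by move=> rs V e z se; apply: V; apply: le_lt_trans se. Qed.

Lemma koszul_vanishing_eq T U r : (forall m, T m <-> U m) ->
  koszul_vanishing T r -> koszul_vanishing U r.
Proof.
move=> TU V e z re ze dz; have [|w wP] := V e z re ze; first by move=> S m /dz/TU.
by exists w => S m /wP/TU.
Qed.

Lemma koszul_vanishing_true T r : (forall m, T m) -> koszul_vanishing T r.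
Proof. by move=> TT e z _ _ _; exists (fun=> 0) => S m _. Qed.

Lemma koszul_vanishing_hits (Y : {set 'I_n}) : koszul_vanishing (hits Y) 0.
Proof.
move=> e z e0 ze dz; apply: koszul_acyclic => // S; apply/eqP.
by apply/negPn/negP => /ze; rewrite mdeg0 => ee; rewrite -ee ltxx in e0.
Qed.

(** The middle of the long exact sequence of the Koszul homology of
0 -> R/(I : a)(-1) -> R/I -> R/(I + a) -> 0.  A cycle z modulo I is, up to the
boundary of a chain w, of the form u + 'X_a v with u in I; then v is a cycle
modulo I : a. *)
Lemma koszul_vanishing_split T a r : (forall m b, T m -> T (m + U_(b))%MM) ->
  koszul_vanishing (fun m => T (m + U_(a))%MM) (r - 1) ->
  koszul_vanishing (fun m => T m \/ (0 < m a)%N) r ->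
  koszul_vanishing T r.
Proof.
move=> Tup Vcolon Vsum e z re ze dz.
have [|w0 w0P] := Vsum e z re ze; first by move=> S m /dz; left.
(* the homogeneous part of w0 serves as well, and it makes v homogeneous *)
pose w S : R^o := mpoly_component (e - 1) (w0 S).
pose p S : R^o := z S - koszul w S.
have pE S : p S = mpoly_component e (z S - koszul w0 S).
  by rewrite raddfB /= mpoly_component_koszul component_homog.
pose v S : R^o := mdivX a (p S).
pose u S : R^o := p S - 'X_a *: v S.
have uT S : mspan T (u S).
  move=> m; rewrite /u mcoeffB mcoeffXM.
  case: (posnP (m a)) => ma; last first.
    by rewrite mcoeff_mdivX submK ?lep1mP -?lt0n // subrr eqxx.
  by rewrite subr0 pE => /(mspan_component (w0P S)) []; rewrite ?ma.
have vh S : of_degree (e - 1) (v S).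
  move=> m; rewrite mcoeff_mdivX pE => /homog_component <-.
  by rewrite mdegD mdeg1 PoszD addrK.
have dv S : mspan (fun m => T (m + U_(a))%MM) (koszul v S).
  rewrite -[koszul v S](mdivXK a); apply: mspan_mdivX.
  have -> : 'X_a * koszul v S = koszul z S - koszul u S.
    rewrite -[LHS]/('X_a *: koszul v S) -koszulZ.
    transitivity (koszul p S - koszul u S); last first.
      by rewrite /p koszulB koszul_koszul subr0.
    have E S' : 'X_a *: v S' = p S' - u S' by rewrite /u opprB addrC subrK.
    by rewrite (eq_koszul E) koszulB.
  apply: mspanB => //; apply: mspan_koszul uT => b m; exact: Tup.
have [|w1 w1P] := Vcolon (e - 1) v _ vh dv; first by rewrite ltrD2r.
exists (fun S => w S + 'X_a *: w1 S) => S.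
have -> : z S - koszul (fun S => w S + 'X_a *: w1 S) S =
    u S + 'X_a *: (v S - koszul w1 S).
  by rewrite koszulD koszulZ scalerBr addrA subrK opprD addrA.
apply: mspanD => //; exact: mspanXM (w1P S).
Qed.

End Vanishing.

(** * Deletion and contraction in antichains of sets *)

Section Families.
Variable X : finType.
Implicit Types (H : {set {set X}}) (A B : {set X}) (a b : X).

Definition star H a : {set {set X}} := [set B in H | a \in B].

(** In the hypergraph, owns H A a says that the edge of a is the singleton of
the vertex A, so A is closed if and only if it owns some a. *)
Definition owns H A a : bool := star H a == [set A].

Definition antichain H : Prop := {in H &, forall A B, A \subset B -> A = B}.

Definition isolated H : Prop := {in H &, forall A B, A != B -> ~~ [disjoint A & B] ->
  [exists a, owns H A a] || [exists a, owns H B a]}.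

(** The variables along which isolated open vertices survive contraction: a
variable shared by two members is owned by none, so erasing it opens no
closed vertex; disjoint members have no
neighbors at all. *)
Definition splitting_point H a : Prop :=
  (1 < #|star H a|)%N \/ {in H &, forall A B, A != B -> [disjoint A & B]}.

Lemma owns_mem H A a : owns H A a -> A \in H /\ a \in A.
Proof. by move=> /eqP/setP/(_ A); rewrite !inE eqxx => /andP[]. Qed.

Lemma owns_inj H A B a : owns H A a -> B \in H -> a \in B -> B = A.
Proof.
move=> /eqP/setP/(_ B); rewrite !inE => /esym AB BH aB.
by apply/eqP; rewrite AB BH.
Qed.

(** Distinct members own distinct elements. *)
Lemma card_owned H (C : {set {set X}}) (L : {set X}) :
  (forall A, A \in C -> exists2 a, owns H A a & a \in L) -> (#|C| <= #|L|)%N.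
Proof.
move=> CL; have [->|[A0 A0C]] := set_0Vmem C; first by rewrite cards0.
have [a0 _ _] := CL _ A0C.
pose f A := odflt a0 [pick a | owns H A a & a \in L].
have fP A : A \in C -> owns H A (f A) /\ f A \in L.
  move=> /CL[a Aa aL]; rewrite /f; case: pickP => [b /andP[]//|/(_ a)].
  by rewrite Aa aL.
rewrite -(card_in_imset (f := f)) => [|A B /fP[Af _] /fP[Bf _] fAB].
  by apply/subset_leq_card/subsetP => _ /imsetP[A /fP[_ fA] ->].
by apply: owns_inj Bf _ _; rewrite -?fAB; have [] := owns_mem Af.
Qed.

Lemma exists_splitting_point H : cover H != set0 ->
  exists2 a, a \in cover H & splitting_point H a.
Proof.
case/set0Pn => a0 a0H.
have [/existsP[a a2]|/existsPn h] := boolP [exists a, (1 < #|star H a|)%N].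
  exists a; last by left.
  have /set0Pn[B] : star H a != set0 by rewrite -card_gt0 ltnW.
  by rewrite inE => /andP[BH aB]; apply/bigcupP; exists B.
exists a0 => //; right => A B AH BH; apply: contra_neqT => /pred0Pn[a /andP[/= aA aB]].
have := h a; rewrite -leqNgt => /card_le1_eqP e1; by apply: e1; rewrite inE ?AH ?BH.
Qed.

(** The generators of I + a other than a itself. *)
Definition deletion H a : {set {set X}} := [set A in H | a \notin A].

Lemma deletion_antichain H a : antichain H -> antichain (deletion H a).
Proof. by move=> anti A B /setIdP[AH _] /setIdP[BH _]; apply: anti. Qed.

Lemma deletion_isolated H a : isolated H -> isolated (deletion H a).
Proof.
move=> iso A B /[dup] AD /setIdP[AH _] /[dup] BD /setIdP[BH _] AB meet.
have own C b : C \in deletion H a -> owns H C b -> owns (deletion H a) C b.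
  move=> CD Cb; apply/eqP/setP => E; move/eqP/setP/(_ E): Cb.
  rewrite !inE; case: eqP => [-> /andP[-> ->]|_]; last first.
    by case: (E \in H) => //= ->; rewrite andbF.
  by move: CD; rewrite inE => /andP[_ ->].
have := iso _ _ AH BH AB meet.
by case/orP => /existsP[b /own ob]; apply/orP; [left|right]; apply/existsP;
  exists b; apply: ob.
Qed.

Lemma card_deletion H a : (#|deletion H a| + #|star H a| = #|H|)%N.
Proof.
rewrite addnC -(cardsID [set A : {set X} | a \in A] H).
by congr (_ + _)%N; apply: eq_card => A; rewrite !inE // andbC.
Qed.

Lemma notin_cover_deletion H a : a \notin cover (deletion H a).
Proof. by apply/bigcupP => -[B]; rewrite inE => /andP[_ /negP]. Qed.

Lemma cover_deletion_sub H a : cover (deletion H a) \subset cover H.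
Proof.
by apply/bigcupsP => B /setIdP[BH _]; apply: bigcup_sup BH.
Qed.

(** Two members through a meet, so at most one of them is open; the element a
pays for that one, and each closed member pays with an element it owns, which
differs from a as a is shared. *)
Lemma cover_deletion H a : a \in cover H -> isolated H -> splitting_point H a ->
  (#|cover (deletion H a)| + #|star H a| <= #|cover H|)%N.
Proof.
move=> aH iso spl.
pose L := cover H :\: cover (deletion H a).
have -> : #|cover H| = (#|cover (deletion H a)| + #|L|)%N.
  rewrite -(cardsID (cover (deletion H a)) (cover H)).
  by rewrite (setIidPr (cover_deletion_sub H a)).
rewrite leq_add2l.
have aL : a \in L by rewrite !inE notin_cover_deletion aH.
case: spl => [two|disj]; last first.
  apply: leq_trans (_ : 1 <= _)%N; last by rewrite card_gt0; apply/set0Pn; exists a.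
  apply/card_le1_eqP => A B; rewrite !inE => /andP[AH aA] /andP[BH aB].
  apply: contraTeq isT => AB; have := disj _ _ BH AH AB.
  by move=> /pred0P/(_ a); rewrite /= aA aB.
pose C := [set B in star H a | [exists b, owns H B b]].
have CL : (#|C| <= #|L :\ a|)%N.
  apply: (@card_owned H) => B /setIdP[]; rewrite inE => /andP[BH aB] /existsP[b Bb].
  exists b => //; rewrite !inE.
  have [_ bB] := owns_mem Bb.
  apply/and3P; split; last by apply/bigcupP; exists B.
    by apply: contraTneq Bb => ->; apply/eqP => E; rewrite E cards1 in two.
  apply/bigcupP => -[E]; rewrite inE => /andP[EH aE] bE.
  by rewrite (owns_inj Bb EH bE) aB in aE.
have CS : (#|star H a :\: C| <= 1)%N.
  apply/card_le1_eqP => A B; rewrite !inE.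
  move=> /andP[nA /andP[AH aA]] /andP[nB /andP[BH aB]].
  apply/eqP; rewrite eq_sym; apply: contraT => AB.
  have meet : ~~ [disjoint A & B] by apply/pred0Pn; exists a; rewrite /= aA aB.
  have := iso _ _ AH BH AB meet.
  by move: nA nB; rewrite AH aA BH aB /= => /negbTE -> /negbTE ->.
rewrite -(cardsID C (star H a)) (cardsD1 a L) aL addnC; apply: leq_add => //.
by apply: leq_trans CL; apply/subset_leq_card/subsetIr.
Qed.

(** The generators made redundant in I : a, being divisible by another
generator stripped of a. *)
Definition absorbed H a : {set {set X}} :=
  [set B in H | (a \notin B) && [exists A in H, (a \in A) && (A :\ a \subset B)]].

Definition contraction H a : {set {set X}} :=
  [set A :\ a | A in H :\: absorbed H a].

Section Contraction.
Variables (H : {set {set X}}) (a : X).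
Hypotheses (anti : antichain H) (iso : isolated H) (a_split : splitting_point H a).
Hypotheses (aH : a \in cover H) (aN : [set a] \notin H).

Lemma kept_subset A B : A \in H :\: absorbed H a -> B \in H :\: absorbed H a ->
  A :\ a \subset B :\ a -> A = B.
Proof.
move=> /setDP[AH nA] /setDP[BH nB] AB.
have [aA|aA] := boolP (a \in A); have [aB|aB] := boolP (a \in B).
- by apply: anti => //; rewrite -(setD1K aA) -(setD1K aB) setUS.
- case/negP: nB; rewrite inE BH aB; apply/existsP; exists A; rewrite AH aA.
  by apply: subset_trans AB _; apply: subsetDl.
- apply: anti => //; apply: subset_trans (subsetDl _ _).
  by apply: subset_trans AB; rewrite subsetD1 subxx.
- by apply: anti => //; apply: subset_trans (subset_trans AB (subsetDl _ _));
    rewrite subsetD1 subxx.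
Qed.

Lemma contraction_antichain : antichain (contraction H a).
Proof.
by move=> _ _ /imsetP[A AK ->] /imsetP[B BK ->] /(kept_subset AK BK) ->.
Qed.

Lemma card_contraction : (#|contraction H a| + #|absorbed H a| = #|H|)%N.
Proof.
rewrite /contraction card_in_imset => [|A B AK BK AB]; last first.
  by apply: kept_subset => //; rewrite AB.
rewrite addnC -(cardsID (absorbed H a) H) (setIidPr _) //.
by apply/subsetP => B /setIdP[].
Qed.

Lemma contraction_owns A b : A \in H :\: absorbed H a -> b != a -> owns H A b ->
  owns (contraction H a) (A :\ a) b.
Proof.
move=> AK ba Ab; have [AH bA] := owns_mem Ab.
have AC : A :\ a \in contraction H a by apply/imsetP; exists A.
apply/eqP/setP => E; apply/setIdP/set1P => [[/imsetP[B BK ->]]|->]; last first.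
  by rewrite AC in_setD1 ba bA.
rewrite in_setD1 ba /= => bB; rewrite (owns_inj Ab _ bB) //.
by case/setDP: BK.
Qed.

Lemma contraction_isolated : isolated (contraction H a).
Proof.
move=> _ _ /imsetP[A AK ->] /imsetP[B BK ->] AB.
move=> /pred0Pn[c /= /andP[/setD1P[ca cA] /setD1P[_ cB]]].
have {}AB : A != B by apply: contraNneq AB => ->.
have meet : ~~ [disjoint A & B] by apply/pred0Pn; exists c; rewrite /= cA cB.
have [AH _] := setDP AK; have [BH _] := setDP BK.
case: a_split => [two|disj]; last by rewrite disj in meet.
have own C b : C \in H :\: absorbed H a -> owns H C b ->
    owns (contraction H a) (C :\ a) b.
  move=> CK Cb; apply: contraction_owns => //.
  by apply: contraTneq Cb => ->; apply/eqP => E; rewrite E cards1 in two.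
by case/orP: (iso AH BH AB meet) => /existsP[b /own ob]; apply/orP; [left|right];
  apply/existsP; exists b; apply: ob.
Qed.

(** If B contains A minus a, then A and B meet outside a, so one of them is
closed.  It cannot be A: the element owned by A would not be a, so it would lie
in B as well. *)
Lemma absorbed_owns B : B \in absorbed H a -> [exists b, owns H B b].
Proof.
case/setIdP => BH /andP[aB /existsP[A /and3P[AH aA AB]]].
have nAB : A != B by apply: contraNneq aB => <-.
have [A0|[c cA]] := set_0Vmem (A :\ a).
  by case/negP: aN; rewrite -(setD1K aA) A0 setU0 in AH.
have cB := subsetP AB _ cA.
have meet : ~~ [disjoint A & B].
  by apply/pred0Pn; exists c; move: cA; rewrite /= cB !inE => /andP[_ ->].
case: a_split => [two|disj]; last by rewrite disj in meet.
case/orP: (iso AH BH nAB meet) => // /existsP[b Ab].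
have [_ bA] := owns_mem Ab.
have ba : b != a by apply: contraTneq Ab => ->; apply/eqP => E; rewrite E cards1 in two.
case/eqP: nAB; apply/esym; apply: (owns_inj Ab BH); apply: (subsetP AB).
by rewrite !inE ba.
Qed.

(** What disappears is a, and one owned element for each absorbed member. *)
Lemma cover_contraction : (#|cover (contraction H a)| + #|absorbed H a| < #|cover H|)%N.
Proof.
pose L := (cover H :\ a) :\: cover (contraction H a).
have sub : cover (contraction H a) \subset cover H :\ a.
  apply/bigcupsP => _ /imsetP[A /setDP[AH _] ->]; apply: setSD; exact: bigcup_sup AH.
have -> : #|cover H| = (#|cover (contraction H a)| + #|L|).+1.
  rewrite (cardsD1 a) aH -(cardsID (cover (contraction H a)) (_ :\ a)).
  by rewrite (setIidPr sub).
rewrite ltnS leq_add2l; apply: (@card_owned H) => B BD.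
have /existsP[b Bb] := absorbed_owns BD; exists b => //.
have [BH bB] := owns_mem Bb; have /setIdP[_ /andP[aB _]] := BD.
rewrite !inE; apply/and3P; split; last by apply/bigcupP; exists B.
  apply/bigcupP => -[_ /imsetP[A /setDP[AH nA] ->] /setD1P[_ bA]].
  by rewrite (owns_inj Bb AH bA) BD in nA.
by apply: contraNneq aB => <-.
Qed.

End Contraction.
End Families.

(** * The bound for antichains of supports *)

Section MonomialIdeals.
Variables (K : fieldType) (n : nat).
Implicit Types (H : {set {set 'I_n}}) (A Y : {set 'I_n}) (a : 'I_n) (m : 'X_{1..n}).

Definition divides A m : bool := [forall a in A, (0 < m a)%N].

(** The monomials of the ideal generated by the square-free monomials with
supports in H together with the variables of Y.  The variables added by
successive splittings are kept in Y, apart from H, so that they count neither as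
vertices nor as labels. *)
Definition generated H Y m : bool := [exists A in H, divides A m] || hits Y m.

Lemma generatedP H Y m :
  reflect ((exists2 A, A \in H & divides A m) \/ (exists2 a, a \in Y & (0 < m a)%N))
    (generated H Y m).
Proof.
apply: (iffP orP) => -[]; first by case/existsP => A /andP[AH Am]; left; exists A.
- by case/existsP => a /andP[aY ma]; right; exists a.
- by case=> A AH Am; left; apply/existsP; exists A; rewrite AH.
by case=> a aY ma; right; apply/existsP; exists a; rewrite aY.
Qed.

Lemma dividesP A m : reflect (forall a, a \in A -> (0 < m a)%N) (divides A m).
Proof. exact: (iffP forall_inP). Qed.

Lemma generatedU H Y m a : generated H Y m -> generated H Y (m + U_(a))%MM.
Proof.
move=> /generatedP[[A AH /dividesP Am]|[b bY mb]]; apply/generatedP; [left|right].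
  by exists A => //; apply/dividesP => b /Am mb; rewrite mnmDE ltn_addr.
by exists b => //; rewrite mnmDE ltn_addr.
Qed.

Lemma generated_deletion H Y a m :
  generated (deletion H a) (a |: Y) m <-> generated H Y m \/ (0 < m a)%N.
Proof.
split=> [/generatedP[[A /setIdP[AH _] Am]|[b /setU1P[->|bY] mb]]|[|ma]].
- by left; apply/generatedP; left; exists A.
- by right.
- by left; apply/generatedP; right; exists b.
- case/generatedP => [[A AH Am]|[b bY mb]]; apply/generatedP; last first.
    by right; exists b; rewrite // inE bY orbT.
  have [aA|aA] := boolP (a \in A); last by left; exists A; rewrite // inE AH.
  by right; exists a; rewrite ?setU11 //; apply: (dividesP _ _ Am).
- by apply/generatedP; right; exists a; rewrite ?setU11.
Qed.

Lemma divides_colon A a m : divides A (m + U_(a))%MM = divides (A :\ a) m.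
Proof.
apply/dividesP/dividesP => Am b; have := Am b; rewrite !inE mnmDE mnm1E.
  by rewrite eq_sym; case: eqP => //= _; rewrite addn0.
by case: (eqVneq b a) => [->|ba] /= mb bA; rewrite ?eqxx ?addn1 // ltn_addr ?mb.
Qed.

Lemma generated_contraction H Y a m : a \notin Y ->
  generated (contraction H a) Y m <-> generated H Y (m + U_(a))%MM.
Proof.
move=> aY; split=> /generatedP[[A AH Am]|[b bY mb]]; apply/generatedP.
- left; case/imsetP: AH => B /setDP[BH _] AE; exists B => //.
  by rewrite divides_colon -AE.
- by right; exists b; rewrite // mnmDE ltn_addr.
- left; rewrite divides_colon in Am.
  have [/setIdP[_ /andP[aA]]|nA] := boolP (A \in absorbed H a); last first.
    by exists (A :\ a) => //; apply/imsetP; exists A; rewrite // inE nA.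
  case/existsP => B /and3P[BH aB /subsetP BA].
  exists (B :\ a).
    by apply/imsetP; exists B; rewrite // !inE BH aB.
  apply/dividesP => c cB; apply: (dividesP _ _ Am); apply/setD1P.
  by split; [case/setD1P: cB | apply: BA].
right; exists b => //; move: mb; rewrite mnmDE mnm1E.
by case: eqP aY => [->|_ _]; rewrite ?bY // addn0.
Qed.

Lemma generated_true H Y a m : a \in Y \/ [set a] \in H ->
  generated H Y (m + U_(a))%MM.
Proof.
have ma : (0 < (m + U_(a))%MM a)%N by rewrite mnmDE mnm1E eqxx addn1.
case=> h; apply/generatedP; [right; exists a | left; exists [set a]] => //.
by apply/dividesP => b /set1P ->.
Qed.

(** Induction on #|cover H|, splitting along a splitting point.  When
the cover is empty, the ideal is either the unit ideal or generated by the
variables of Y. *)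
Lemma koszul_vanishing_antichain H Y : antichain H -> isolated H ->
  @koszul_vanishing K n (generated H Y) (#|cover H|%:Z - #|H|%:Z).
Proof.
have [k] := ubnP #|cover H|; elim: k => // k IH in H Y *.
rewrite ltnS => Hk anti iso.
have [cov0|/exists_splitting_point[a aH spl]] := eqVneq (cover H) set0.
  have [H0|H0] := boolP (set0 \in H).
    apply: koszul_vanishing_true => m; apply/generatedP; left; exists set0 => //.
    by apply/dividesP => a; rewrite inE.
  have HE : H = set0.
    apply/setP => A; rewrite inE; apply: contraNF H0 => AH.
    by have /eqP <- : A == set0 by rewrite -subset0 -cov0 (bigcup_sup A).
  rewrite cov0 HE !cards0 subrr.
  apply: (@koszul_vanishing_eq _ _ (hits Y)); last exact: koszul_vanishing_hits.
  move=> m; rewrite /generated; case: existsP => //= -[A].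
  by rewrite inE.
apply: (koszul_vanishing_split (a := a)) => [m b||]; first exact: generatedU.
  have [aY|aY] := boolP (a \in Y).
    by apply: koszul_vanishing_true => m; apply: generated_true; left.
  have [aH1|aH1] := boolP ([set a] \in H).
    by apply: koszul_vanishing_true => m; apply: generated_true; right.
  have lt := cover_contraction iso spl aH aH1.
  apply: (@koszul_vanishing_eq _ _ (generated (contraction H a) Y)).
    by move=> m; apply: generated_contraction.
  apply: (koszul_vanishing_le _ (IH _ _ _ _ _)).
  - have := card_contraction a anti; move: lt; lia.
  - by apply: leq_trans Hk; apply: leq_ltn_trans lt; rewrite leq_addr.
  - exact: contraction_antichain.
  exact: contraction_isolated.
have le := cover_deletion aH iso spl.
apply: (@koszul_vanishing_eq _ _ (generated (deletion H a) (a |: Y))).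
  by move=> m; apply: generated_deletion.
apply: (koszul_vanishing_le _ (IH _ _ _ _ _)).
- have := card_deletion H a; move: le; lia.
- apply: leq_trans Hk; apply: proper_card; apply/properP.
  by split; [apply: cover_deletion_sub | exists a; rewrite // notin_cover_deletion].
- exact: deletion_antichain.
exact: deletion_isolated.
Qed.

End MonomialIdeals.

(** * Koszul homology and minimal resolutions *)

Section Rows.
Variables (K : fieldType) (n : nat).
Local Notation R := {mpoly K[n]}.

Lemma koszul_coord (k : nat) (z : {set 'I_n} -> 'rV[R]_k) S i :
  koszul z S 0 i = koszul (fun S => z S 0 i : R^o) S.
Proof. by rewrite summxE; apply: eq_bigr => a _; rewrite mxE. Qed.

Lemma koszul_mulmxr (k l : nat) (A : 'M[R]_(k, l)) (z : {set 'I_n} -> 'rV[R]_k) S :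
  koszul (fun S => z S *m A) S = koszul z S *m A.
Proof. by rewrite mulmx_suml; apply: eq_bigr => a _; rewrite scalemxAl. Qed.

Lemma mpoly_degreeM d e (p q : R) :
  mpoly_degree d p -> mpoly_degree e q -> mpoly_degree (d + e) (p * q).
Proof.
rewrite !mpoly_degreeP; apply: mspanM => m k <- <-.
by rewrite mdegD PoszD.
Qed.

Definition row_degree (k : nat) (s : 'I_k -> int) (e : int) (u : 'rV[R]_k) : Prop :=
  forall i, mpoly_degree (e - s i) (u 0 i).

Lemma row_degree_mulmx (k l : nat) (s : 'I_k -> int) (t : 'I_l -> int)
    (A : 'M[R]_(k, l)) e u :
  (forall i j, mpoly_degree (s i - t j) (A i j)) ->
  row_degree s e u -> row_degree t e (u *m A).
Proof.
move=> At us j; rewrite mxE; apply/mpoly_degreeP; apply: mspan_sum => i _.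
apply/mpoly_degreeP; have -> : e - t j = (e - s i) + (s i - t j) by ring.
exact: mpoly_degreeM.
Qed.

(** Acyclicity of the Koszul complex of a graded free module, with a primitive
that is again homogeneous. *)
Lemma koszul_acyclic_row (k : nat) (s : 'I_k -> int) e (z : {set 'I_n} -> 'rV[R]_k) :
  (forall S, row_degree s e (z S)) -> (forall S, koszul z S = 0) ->
  (forall S i, (z S 0 i)@_0%MM = 0) ->
  exists2 y : {set 'I_n} -> 'rV[R]_k,
    forall S, row_degree s (e - 1) (y S) & forall S, z S = koszul y S.
Proof.
move=> zs dz z0.
have [i|y yP] := @fin_all_exists _ (fun=> {set 'I_n} -> R^o)
    (fun i y => forall S, z S 0 i = koszul y S).
  have [S|S|y yP] := @koszul_acyclic K n set0 (fun S => z S 0 i).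
  - by rewrite -koszul_coord dz mxE; apply: mspan0.
  - exact: z0.
  exists y => S; apply/eqP; rewrite -subr_eq0; apply/eqP/mpolyP => m.
  rewrite mcoeff0; apply/eqP/negPn/negP => /yP/existsP[a].
  by rewrite inE.
exists (fun S => \row_i mpoly_component (e - 1 - s i) (y i S)) => S.
  by move=> i; rewrite mxE; apply/mpoly_degreeP/homog_component.
apply/rowP => i; rewrite koszul_coord.
rewrite -[LHS](component_homog (d := e - s i)); last exact/mpoly_degreeP/zs.
rewrite yP mpoly_component_koszul.
by apply: (@eq_koszul K n R^o) => S'; rewrite mxE addrAC.
Qed.

End Rows.

Section Resolutions.
Variables (K : fieldType) (n : nat).
Local Notation R := {mpoly K[n]}.
Variables (M : lmodType R) (gr : int -> M -> Prop).

(** H_i(x; M)_j vanishes for j - i > r. *)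
Definition koszul_regular (r : int) : Prop :=
  forall (e : int) (z : {set 'I_n} -> M), r < e ->
  (forall S, gr e (z S)) -> (forall S, koszul z S = 0) ->
  exists w : {set 'I_n} -> M, forall S, z S = koszul w S.

Hypothesis gr0 : forall d, gr d 0.
Hypothesis grD : forall d x y, gr d x -> gr d y -> gr d (x + y).
Hypothesis grZ : forall d e p x, mpoly_degree d p -> gr e x -> gr (d + e) (p *: x).

Variable F : minimal_graded_free_resolution gr.

(** Koszul regularity of the cokernel of mres_diff F t, that is, of M for t = 0
and of the t-th syzygy module in general, written with representatives in
the free module. *)
Definition syzygy_regular (t : nat) (r : int) : Prop :=
  forall (e : int) (z : {set 'I_n} -> 'rV[R]_(mres_rank F t)), r < e ->
  (forall S, row_degree (@mres_shift _ _ _ _ F t) e (z S)) ->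
  (forall S, exists v, koszul z S = v *m mres_diff F t) ->
  exists w v : {set 'I_n} -> _, forall S, z S = koszul w S + v S *m mres_diff F t.

Lemma syzygy_regular0 r : koszul_regular r -> syzygy_regular 0 r.
Proof.
move=> V e z re ze dz.
have [||w wP] := V e (fun S => mres_aug F (z S)) re.
- move=> S; rewrite [z S]row_sum_delta raddf_sum /=.
  elim/big_ind: _ => [||k _]; [exact: gr0 | move=> x y; exact: grD|].
  rewrite linearZ -[e](subrK (mres_shift k)); apply: grZ; first exact: ze.
  exact: mres_aug_graded.
- by move=> S; rewrite -koszul_linear; apply/mres_exact0.
have [S|w' w'P] := @fin_all_exists _ _ (fun S u => mres_aug F u = w S).
  exact: mres_aug_surj.
have [S|v vP] := @fin_all_exists _ _ (fun S v => z S - koszul w' S = v *m mres_diff F 0).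
  apply/mres_exact0; rewrite raddfB /= koszul_linear wP; apply/eqP; rewrite subr_eq0.
  by apply/eqP/eq_koszul => S'; rewrite w'P.
by exists w', v => S; rewrite -vP addrC subrK.
Qed.

(** The connecting map of 0 -> N' -> F_t -> N -> 0, made explicit.  The image of
z in F_t is a cycle, hence a boundary of some y; here minimality provides the
vanishing of the constant terms, which takes care of H_0.  As y is a cycle
modulo the syzygies, it is a boundary modulo them, and the correction it
provides is the chain sought. *)
Lemma syzygy_regularS t r : syzygy_regular t r -> syzygy_regular t.+1 (r + 1).
Proof.
move=> V e z re ze dz.
have [S|S|S i|y ye yP] := @koszul_acyclic_row K n _ (@mres_shift _ _ _ _ F t) e
    (fun S => z S *m mres_diff F t).
- apply: row_degree_mulmx (ze S); exact: mres_diff_graded.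
- by rewrite koszul_mulmxr; apply/mres_exactS; apply: dz.
- rewrite mxE raddf_sum big1 //= => k _.
  by rewrite rmorphM /= mres_minimal mulr0.
have [|||w [t' wP]] := V (e - 1) y; first by lia.
- by [].
- by move=> S; exists (z S); rewrite -yP.
have [S|v vP] := @fin_all_exists _ _
    (fun S v => z S - koszul t' S = v *m mres_diff F t.+1).
  apply/mres_exactS; rewrite mulmxBl yP (eq_koszul wP) koszulD koszul_koszul add0r.
  by rewrite koszul_mulmxr subrr.
by exists t', v => S; rewrite -vP addrC subrK.
Qed.

(** A basis vector of large degree, placed at the empty set, is a cycle.  If it
were a boundary modulo the syzygies, its coordinate 1 would have no constant
term. *)
Lemma syzygy_regular_shift t r : syzygy_regular t r ->
  forall k : 'I_(mres_rank F t), mres_shift k <= r.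
Proof.
move=> V k; rewrite leNgt; apply/negP => rk.
have [|S|w [v wP]] := V _ (fun S => if S == set0 then delta_mx 0 k else 0) rk.
- move=> S i; case: eqP => _; rewrite mxE; last by apply/mpoly_degreeP; apply: mspan0.
  rewrite eqxx andTb; case: (i =P k) => [->|_]; last first.
    by apply/mpoly_degreeP; apply: mspan0.
  by rewrite subrr; apply: dhomog1.
- exists 0; rewrite mul0mx; apply: big1 => a _.
  rewrite ifN ?scaler0 //; apply/set0Pn; exists a; exact: setU11.
have /(congr1 (fun u : 'rV[R]_ _ => (u 0 k)@_0%MM)) := wP set0.
rewrite eqxx mxE !eqxx mxE mcoeffD koszul_coord koszulE mxE !raddf_sum /=.
rewrite !big1 => [|i _|a _].
- by rewrite mcoeff1 eqxx addr0 => /eqP; rewrite oner_eq0.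
- by rewrite rmorphM /= mres_minimal mulr0.
by rewrite mulrCA mcoeffXM mnm0E.
Qed.

Lemma resolution_shift_le r : koszul_regular r ->
  forall t (k : 'I_(mres_rank F t)), mres_shift k - t%:Z <= r.
Proof.
move=> V t; suff Vt : syzygy_regular t (r + t%:Z).
  by move=> k; rewrite lerBlDr; apply: syzygy_regular_shift.
elim: t => [|t IH]; first by rewrite addr0; apply: syzygy_regular0.
by rewrite -addn1 PoszD addrA addn1; apply: syzygy_regularS.
Qed.

End Resolutions.

(** * Regularity as a supremum *)

Section Regularity.
Variables (K : fieldType) (n : nat).
Local Notation R := {mpoly K[n]}.

Lemma int_has_max (P : int -> Prop) (b d0 : int) :
  (forall d, P d -> d <= b) -> P d0 -> exists2 d, P d & forall e, P e -> e <= d.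
Proof.
move=> Pb; have [k] := ubnP `|b - d0|%N; elim: k d0 => // k IH d dk Pd.
have [[e [Pe de]]|no] := EM (exists e, P e /\ d < e).
  by apply: (IH e) => //; have := Pb _ Pe; lia.
exists d => // e Pe; rewrite leNgt; apply/negP => de.
by apply: no; exists e.
Qed.

(** A nonzero graded_betti value counts basis vectors in some resolution.  The
Betti indices being bounded, they have a least upper bound, -oo when there are
none; so regularity is a genuine supremum. *)
Lemma regularity_le (M : lmodType R) (gr : int -> M -> Prop) (b : int) :
  (forall (F : minimal_graded_free_resolution gr) t (k : 'I_(mres_rank F t)),
     mres_shift k - t%:Z <= b) ->
  (regularity gr <= b%:E)%O.
Proof.
move=> Fb.
have betti_b i j : graded_betti gr i j <> 0%N -> j - i%:Z <= b.
  rewrite /graded_betti; case: classical_sets.xgetP => // c -> [F Fc] c0.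
  have /set0Pn[k] : [set k : 'I_(mres_rank F i) | mres_shift k == j] != set0.
    by rewrite -card_gt0 Fc lt0n; apply/eqP.
  by rewrite inE => /eqP <-.
have [r rP] : exists r, is_regularity gr r.
  pose P d := exists i j, graded_betti gr i j <> 0%N /\ d = j - i%:Z.
  have [[d0 Pd0]|noP] := EM (exists d, P d).
    have [|d [i [j [ij ->]]] dmax] := @int_has_max P b d0 _ Pd0.
      by move=> d [i [j [/betti_b ij ->]]].
    exists (j - i%:Z)%:E; split=> [i' j' ij'|s]; last exact.
    by rewrite lee_fin; apply: dmax; exists i', j'.
  exists -oo%E; split=> [i j ij|s _]; last exact: leNye.
  by case: noP; exists (j - i%:Z), i, j.
have [_ ] := classical_sets.xgetPex +oo%E (ex_intro _ r rP).
by apply=> i j /betti_b; rewrite lee_fin.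
Qed.

End Regularity.

(** * Quotients of the polynomial ring *)

Section MonomialQuotient.
Variables (K : fieldType) (n : nat) (I : ideal {mpoly K[n]}).
Local Notation R := {mpoly K[n]}.

Fact quotmod_proj_is_zmod_morphism : zmod_morphism (quotmod_proj I).
Proof. exact: quotmod_projB. Qed.

HB.instance Definition _ :=
  GRing.isZmodMorphism.Build R^o (quotmod I) (quotmod_proj I)
    quotmod_proj_is_zmod_morphism.

Fact quotmod_proj_is_scalable : scalable (quotmod_proj I).
Proof. by move=> c x; apply: quotmod_projZ. Qed.

HB.instance Definition _ :=
  GRing.isScalable.Build R R^o (quotmod I) *:%R (quotmod_proj I)
    quotmod_proj_is_scalable.

Lemma quotmod_proj_eq0 p : quotmod_proj I p = 0 <-> p \in I.
Proof. by rewrite -(raddf0 (quotmod_proj I)) quotmod_projP subr0. Qed.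

Lemma quot_grading0 d : @quot_grading _ _ I d 0.
Proof.
by exists 0; [apply/mpoly_degreeP; apply: mspan0 | rewrite raddf0].
Qed.

Lemma quot_gradingD d x y :
  @quot_grading _ _ I d x -> @quot_grading _ _ I d y -> @quot_grading _ _ I d (x + y).
Proof.
move=> [p pd ->] [q qd ->]; exists (p + q); last by rewrite raddfD.
by apply/mpoly_degreeP; apply: mspanD; apply/mpoly_degreeP.
Qed.

Lemma quot_gradingZ d e p x :
  mpoly_degree d p -> @quot_grading _ _ I e x -> @quot_grading _ _ I (d + e) (p *: x).
Proof.
move=> pd [q qe ->]; exists (p * q); first exact: mpoly_degreeM.
by rewrite -[p * q]/(p *: (q : R^o)) linearZ.
Qed.

Lemma quot_koszul_regular (T : 'X_{1..n} -> Prop) r :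
  (forall p, p \in I <-> mspan T p) -> koszul_vanishing K T r ->
  koszul_regular (@quot_grading K n I) r.
Proof.
move=> IT V e z re ze dz.
have [S|p pe zp] := @fin_all_exists2 _ (fun=> R)
    (fun _ p => mpoly_degree e p) (fun S p => z S = quotmod_proj I p).
  exact: ze.
have [S|S|w wP] := V e p re.
- exact/mpoly_degreeP.
- apply/IT/quotmod_proj_eq0; rewrite koszul_linear -[RHS](dz S).
  by apply: eq_koszul => S'; rewrite zp.
exists (fun S => quotmod_proj I (w S)) => S; rewrite zp.
by rewrite -koszul_linear; apply/quotmod_projP/IT.
Qed.

End MonomialQuotient.

(** * Generators, supports and the hypergraph *)

Section Generators.
Variables (K : fieldType) (n : nat).
Local Notation R := {mpoly K[n]}.
Implicit Types (G : 'X_{1..n} -> Prop) (I : ideal R).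

Definition multiple_of G m : Prop := exists2 s, G s & (s <= m)%MM.

Lemma mspan_generators G (p : R) :
  (exists s : seq (R * 'X_{1..n}),
      (forall x, x \in s -> G x.2) /\ p = \sum_(x <- s) x.1 * 'X_[x.2]) <->
  mspan (multiple_of G) p.
Proof.
split=> [[s [sG ->]]|pG].
  rewrite big_seq; apply: mspan_sum => x /sG Gx.
  apply: (mspanM (T := fun=> True) (U := eq x.2)) => [m _ _ <-|//|m].
    by exists x.2; rewrite // lem_addl.
  by rewrite mcoeffX; case: (x.2 =P m) => // _; rewrite eqxx.
rewrite [p]mpolyE big_seq; elim/big_ind: _ => [|q q' [s [sG ->]] [s' [sG' ->]]|m].
- by exists [::]; rewrite big_nil.
- exists (s ++ s'); rewrite big_cat; split=> // x.
  by rewrite mem_cat => /orP[/sG|/sG'].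
rewrite mcoeff_msupp => /pG[s Gs sm].
exists [:: (p@_m *: 'X_[m - s], s)]; rewrite big_seq1; split=> /=.
  by move=> x; rewrite inE => /eqP ->.
by rewrite -scalerAl -mpolyXD submK.
Qed.

Lemma monomials_generateP G I :
  monomials_generate G I <-> (forall p, p \in I <-> mspan (multiple_of G) p).
Proof. by split=> h p; rewrite h mspan_generators. Qed.

Lemma mspanX T m : mspan T ('X_[m] : R) <-> T m.
Proof.
split=> [h|Tm k]; first by apply: h; rewrite mcoeffX eqxx oner_eq0.
by rewrite mcoeffX; case: (m =P k) => [<- //|_]; rewrite eqxx.
Qed.

(** Otherwise f j could be dropped from the generators. *)
Lemma minimal_generators_antichain mu (f : 'I_mu -> 'X_{1..n}) I :
  minimal_monomial_generators f I -> forall j k, (f k <= f j)%MM -> k = j.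
Proof.
case=> _ /monomials_generateP gen min j k kj; apply/eqP; apply: contraT => neq.
have : j \in [set: 'I_mu] by rewrite inE.
rewrite -(min (setT :\ j)) ?setD11 //; apply/monomials_generateP => p.
rewrite gen; split=> pG m /pG[s [i]].
  move=> <- im; have [ij|ij] := eqVneq i j.
    exists (f k); first by exists k; rewrite // !inE neq.
    by apply: lepm_trans im; rewrite ij.
  by exists (f i) => //; exists i; rewrite // !inE ij.
by move=> _ <- im; exists (f i) => //; exists i.
Qed.

(** The ideal contains a square-free monomial s dividing f j, and a minimal
generator dividing s must be f j itself. *)
Lemma minimal_generators_squarefree mu (f : 'I_mu -> 'X_{1..n}) I :
  squarefree_monomial_ideal I -> minimal_monomial_generators f I ->
  forall j, squarefree (f j).
Proof.
move=> [G [Gsf /monomials_generateP genG]] fmin j.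
have [_ /monomials_generateP genf _] := fmin.
have inI m : multiple_of G m <-> multiple_of (fun m => exists j, f j = m) m.
  by rewrite -!mspanX -genG -genf.
have [s Gs sj] : multiple_of G (f j).
  by apply/inI; exists (f j); [exists j | apply: lepm_refl].
have [_ [k <-] ks] : multiple_of (fun m => exists j, f j = m) s.
  by apply/inI; exists s => //; apply: lepm_refl.
have kj := minimal_generators_antichain fmin (lepm_trans ks sj).
move=> a; apply: leq_trans (Gsf _ Gs a).
by rewrite kj in ks; apply: (mnm_lepP ks).
Qed.

End Generators.

Section Hypergraph.
Variables (n mu : nat) (f : 'I_mu -> 'X_{1..n}).
Hypothesis f_sqfree : forall j, squarefree (f j).
Hypothesis f_anti : forall j k, (f k <= f j)%MM -> k = j.

Definition monomial_support j : {set 'I_n} := [set a | (0 < f j a)%N].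

Definition supports : {set {set 'I_n}} := [set monomial_support j | j : 'I_mu].

Lemma divides_support j m : divides (monomial_support j) m = (f j <= m)%MM.
Proof.
apply/dividesP/mnm_lepP => [h a|h a]; last by rewrite inE => /leq_trans; apply.
have [->//|fa] := posnP (f j a).
by apply: leq_trans (f_sqfree j a) (h a _); rewrite inE.
Qed.

Lemma monomial_support_sub j k : monomial_support k \subset monomial_support j -> k = j.
Proof.
move/subsetP => h; apply: f_anti; rewrite -divides_support.
by apply/dividesP => a /h; rewrite inE.
Qed.

Lemma monomial_support_inj : injective monomial_support.
Proof. by move=> j k jk; apply: monomial_support_sub; rewrite jk. Qed.

Lemma card_supports : #|supports| = mu.
Proof. by rewrite card_imset ?card_ord //; apply: monomial_support_inj. Qed.

Lemma supports_antichain : antichain supports.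
Proof. by move=> _ _ /imsetP[j _ ->] /imsetP[k _ ->] /monomial_support_sub ->. Qed.

Lemma cover_supports : cover supports = hg_labels (hypergraph_of f).
Proof.
apply/setP => a; rewrite inE; apply/bigcupP/set0Pn => [[_ /imsetP[j _ ->]]|[j]].
  by rewrite inE => fa; exists j; rewrite inE lep1mP -lt0n.
rewrite inE lep1mP -lt0n => fa; exists (monomial_support j); last by rewrite inE.
exact: imset_f.
Qed.

Lemma closed_owns j : hg_closed (hypergraph_of f) j ->
  [exists a, owns supports (monomial_support j) a].
Proof.
case/imsetP => a _ Ea; apply/existsP; exists a; apply/eqP/setP => A.
apply/setIdP/set1P => [[/imsetP[k _ ->]]|->].
  rewrite inE => fa; have : k \in hypergraph_of f a by rewrite inE lep1mP -lt0n.
  by rewrite -Ea => /set1P ->.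
split; first exact: imset_f.
by have := set11 j; rewrite Ea !inE lep1mP -lt0n.
Qed.

Lemma supports_isolated : isolated_open_vertices (hypergraph_of f) -> isolated supports.
Proof.
move=> iso _ _ /imsetP[j _ ->] /imsetP[k _ ->] jk /pred0Pn[a /= /andP[aj ak]].
rewrite !inE in aj ak.
have [/closed_owns->//|oj] := boolP (hg_closed (hypergraph_of f) j).
rewrite [X in _ || X]closed_owns ?orbT //; apply: (iso j) => //; rewrite inE.
apply/andP; split; first by apply: contraNneq jk => ->.
apply/existsP; exists (hypergraph_of f a).
by rewrite imset_f //= !inE !lep1mP -!lt0n aj ak.
Qed.

Lemma generated_supports m :
  multiple_of (fun m => exists j, f j = m) m <-> generated supports set0 m.
Proof.
split=> [[_ [j <-] jm]|/generatedP[[_ /imsetP[j _ ->]]|[a]]].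
- apply/generatedP; left; exists (monomial_support j); first exact: imset_f.
  by rewrite divides_support.
- by rewrite divides_support => jm; exists (f j) => //; exists j.
by rewrite inE.
Qed.

End Hypergraph.

Theorem theorem4p4 (K : fieldType) (n : nat) (I : ideal {mpoly K[n]})
    (mu : nat) (f : 'I_mu -> 'X_{1..n}) :
  squarefree_monomial_ideal I ->
  minimal_monomial_generators f I ->
  isolated_open_vertices (hypergraph_of f) ->
  (reg_quot I <= (#|hg_labels (hypergraph_of f)|%:Z - #|'I_mu|%:Z)%:E)%O.
Proof.
move=> Isf fmin iso.
have fsf := minimal_generators_squarefree Isf fmin.
have fanti := minimal_generators_antichain fmin.
have V := @koszul_vanishing_antichain K n _ set0
  (supports_antichain fsf fanti) (supports_isolated iso).
rewrite cover_supports card_supports // in V; rewrite card_ord.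
apply: regularity_le => F; apply: resolution_shift_le.
- exact: quot_grading0.
- exact: quot_gradingD.
- exact: quot_gradingZ.
apply: quot_koszul_regular V => p.
have [_ /monomials_generateP gen _] := fmin.
by rewrite gen; split=> h m /h/generated_supports; apply.
Qed.
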